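(* (i) The timelike general rotational surface of first type $\mathcal{M}_1$ is minimal if and only if, up to parametrization, the meridian curve is determined by $c: x(u)=(f(u),0,0,u)$, where $f(u)$ is given by the formula $$f=\frac{\sqrt{A}}{\alpha}\,\sin\left(\varepsilon\,\frac{\alpha}{\beta}\,\ln\left|\beta u+\sqrt{A+\beta^2u^2}\right|+C\right);\quad A=const,\ C=const,\ \varepsilon=\pm1.$$ (ii) The timelike general rotational surface of second type $\mathcal{M}_2$ is minimal if and only if, up to parametrization, the meridian curve is determined by $c: x(u)=(f(u),0,u,0)$, where $f(u)$ is given by the formula $$f=\frac{\sqrt{A}}{\alpha}\,\sin\left(\varepsilon\,\frac{\alpha}{\beta}\,\ln\left|\beta u+\sqrt{\beta^2u^2-A}\right|+C\right);\quad A=const,\ C=const,\ \varepsilon=\pm1.$$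
   Context: $\mathbb{R}^4_1$ is the four-dimensional Minkowski space, i.e. $\mathbb{R}^4$ with the flat metric $\langle\cdot,\cdot\rangle = dx_1^2+dx_2^2+dx_3^2-dx_4^2$. A surface in it is timelike if the induced metric has index 1. Let $J\subset\mathbb{R}$ be an interval, $f,g$ smooth functions on $J$, $\alpha,\beta$ positive constants, $u\in J$, $v\in[0,2\pi)$; a prime denotes $d/du$. Timelike general rotational surface of first type: $$\mathcal{M}_1: z(u,v)=(f(u)\cos\alpha v,\ f(u)\sin\alpha v,\ g(u)\sinh\beta v,\ g(u)\cosh\beta v),$$ where $f'^2-g'^2<0$ and $\alpha^2f^2+\beta^2g^2>0$. Its meridian curve is $c: x(u)=(f(u),0,0,g(u))$. Timelike general rotational surface of second type: $$\mathcal{M}_2: z(u,v)=(f(u)\cos\alpha v,\ f(u)\sin\alpha v,\ g(u)\cosh\beta v,\ g(u)\sinh\beta v),$$ where $\alpha^2f^2-\beta^2g^2<0$ and $f'^2+g'^2>0$. Its meridian curve is $c: x(u)=(f(u),0,g(u),0)$. Standing assumption: all surfaces are free of inflection points. This means that, for an orthonormal normal frame $\{n_1,n_2\}$ and $c_{11}^k=\langle z_{uu},n_k\rangle$, $c_{12}^k=\langle z_{uv},n_k\rangle$, $c_{22}^k=\langle z_{vv},n_k\rangle$ ($k=1,2$), the three determinants $\Delta_1=c_{11}^1c_{12}^2-c_{12}^1c_{11}^2$, $\Delta_2=c_{11}^1c_{22}^2-c_{22}^1c_{11}^2$, $\Delta_3=c_{12}^1c_{22}^2-c_{22}^1c_{12}^2$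 do not all vanish at any point. The second fundamental tensor $\sigma(x,y)$ is the normal component of $\widetilde\nabla_xy$ for $x,y$ tangent ($\widetilde\nabla$ the Levi-Civita connection of $\mathbb{R}^4_1$), and the mean curvature vector field is $H=\tfrac12\operatorname{tr}\sigma$ (trace with respect to the induced metric). A surface is minimal if $H$ vanishes.
   Formalization: In (ii) the equivalence is stated when g' has no zero on J; without that, M_2 is minimal iff the zeros of g' contain no interval and the formula holds on each subinterval with g' nonzero. Literal (ii) fails for f=(a/α)sin(αs), g=(a/β)cosh(βs) near s=0. *)

(* Defs.v *)
From Stdlib Require Import Reals.
From Coquelicot Require Import Coquelicot.
Open Scope R_scope.

Definition is_interval (J : R -> Prop) : Prop :=
  (forall a b x, J a -> J b -> a <= x <= b -> J x) /\
  (exists a b, J a /\ J b /\ a < b).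

(** At an endpoint belonging to [J] the derivatives are two-sided: a function
    that is smooth on a non-open interval is represented by a smooth extension.
    The derivatives at points of [J] only depend on the values on [J], because
    [J] is not reduced to a point. *)
Definition smooth_on (J : R -> Prop) (f : R -> R) : Prop :=
  forall (n : nat) (x : R), J x -> ex_derive_n f n x.

Notation R4 := (R * R * R * R)%type.

Definition mdot (x y : R4) : R :=
  let '(x1, x2, x3, x4) := x in
  let '(y1, y2, y3, y4) := y in
  x1 * y1 + x2 * y2 + x3 * y3 - x4 * y4.

Definition Derive4 (c : R -> R4) (t : R) : R4 :=
  (Derive (fun s => fst (fst (fst (c s)))) t,
   Derive (fun s => snd (fst (fst (c s)))) t,
   Derive (fun s => snd (fst (c s))) t,
   Derive (fun s => snd (c s)) t).

Definition d_u (z : R -> R -> R4) (u v : R) : R4 := Derive4 (fun s => z s v) u.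
Definition d_v (z : R -> R -> R4) (u v : R) : R4 := Derive4 (fun t => z u t) v.

Definition z_uu (z : R -> R -> R4) : R -> R -> R4 := d_u (d_u z).
Definition z_uv (z : R -> R -> R4) : R -> R -> R4 := d_v (d_u z).
Definition z_vv (z : R -> R -> R4) : R -> R -> R4 := d_v (d_v z).

Definition ffE (z : R -> R -> R4) (u v : R) : R := mdot (d_u z u v) (d_u z u v).
Definition ffF (z : R -> R -> R4) (u v : R) : R := mdot (d_u z u v) (d_v z u v).
Definition ffG (z : R -> R -> R4) (u v : R) : R := mdot (d_v z u v) (d_v z u v).
Definition ffdet (z : R -> R -> R4) (u v : R) : R :=
  ffE z u v * ffG z u v - ffF z u v ^ 2.

Definition tangential_part (z : R -> R -> R4) (u v : R) (w : R4) : R4 :=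
  let a := mdot w (d_u z u v) in
  let b := mdot w (d_v z u v) in
  plus (scal ((ffG z u v * a - ffF z u v * b) / ffdet z u v) (d_u z u v))
       (scal ((ffE z u v * b - ffF z u v * a) / ffdet z u v) (d_v z u v)).

Definition normal_part (z : R -> R -> R4) (u v : R) (w : R4) : R4 :=
  minus w (tangential_part z u v w).

(** The ambient connection is the flat one, so the covariant derivatives of the
    coordinate fields are the second partial derivatives of [z]. *)
Definition sigma_uu (z : R -> R -> R4) (u v : R) : R4 := normal_part z u v (z_uu z u v).
Definition sigma_uv (z : R -> R -> R4) (u v : R) : R4 := normal_part z u v (z_uv z u v).
Definition sigma_vv (z : R -> R -> R4) (u v : R) : R4 := normal_part z u v (z_vv z u v).

(** The trace is taken with the inverse of the matrix [(E, F; F, G)]. *)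
Definition tr_sigma (z : R -> R -> R4) (u v : R) : R4 :=
  plus (plus (scal (ffG z u v / ffdet z u v) (sigma_uu z u v))
             (scal (- 2 * ffF z u v / ffdet z u v) (sigma_uv z u v)))
       (scal (ffE z u v / ffdet z u v) (sigma_vv z u v)).

Definition mean_curvature (z : R -> R -> R4) (u v : R) : R4 :=
  scal (1 / 2) (tr_sigma z u v).

Definition is_minimal (J : R -> Prop) (z : R -> R -> R4) : Prop :=
  forall u v, J u -> 0 <= v < 2 * PI -> mean_curvature z u v = zero.

(** The surfaces considered are timelike, so their normal planes are
    spacelike. *)
Definition orthonormal_normal_frame
    (z : R -> R -> R4) (u v : R) (n1 n2 : R4) : Prop :=
  mdot n1 (d_u z u v) = 0 /\ mdot n1 (d_v z u v) = 0 /\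
  mdot n2 (d_u z u v) = 0 /\ mdot n2 (d_v z u v) = 0 /\
  mdot n1 n1 = 1 /\ mdot n2 n2 = 1 /\ mdot n1 n2 = 0.

Definition Delta (p q n1 n2 : R4) : R :=
  mdot p n1 * mdot q n2 - mdot q n1 * mdot p n2.

(** The vanishing of the three determinants does not depend on the frame. *)
Definition inflection_point (z : R -> R -> R4) (u v : R) : Prop :=
  exists n1 n2 : R4,
    orthonormal_normal_frame z u v n1 n2 /\
    Delta (z_uu z u v) (z_uv z u v) n1 n2 = 0 /\
    Delta (z_uu z u v) (z_vv z u v) n1 n2 = 0 /\
    Delta (z_uv z u v) (z_vv z u v) n1 n2 = 0.

Definition free_of_inflection_points (J : R -> Prop) (z : R -> R -> R4) : Prop :=
  forall u v, J u -> 0 <= v < 2 * PI -> ~ inflection_point z u v.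

Definition M1 (alpha beta : R) (f g : R -> R) (u v : R) : R4 :=
  (f u * cos (alpha * v), f u * sin (alpha * v),
   g u * sinh (beta * v), g u * cosh (beta * v)).

Definition M2 (alpha beta : R) (f g : R -> R) (u v : R) : R4 :=
  (f u * cos (alpha * v), f u * sin (alpha * v),
   g u * cosh (beta * v), g u * sinh (beta * v)).

Definition timelike_first_type
    (alpha beta : R) (J : R -> Prop) (f g : R -> R) : Prop :=
  forall u, J u ->
    Derive f u ^ 2 - Derive g u ^ 2 < 0 /\
    alpha ^ 2 * f u ^ 2 + beta ^ 2 * g u ^ 2 > 0.

Definition timelike_second_type
    (alpha beta : R) (J : R -> Prop) (f g : R -> R) : Prop :=
  forall u, J u ->
    alpha ^ 2 * f u ^ 2 - beta ^ 2 * g u ^ 2 < 0 /\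
    Derive f u ^ 2 + Derive g u ^ 2 > 0.

Definition meridian1 (f g : R -> R) (u : R) : R4 := (f u, 0, 0, g u).
Definition meridian2 (f g : R -> R) (u : R) : R4 := (f u, 0, g u, 0).

(** [y] on [J'] is the curve [x] on [J] written in the new parameter [h u];
    on an interval, [h' <> 0] makes [h] a diffeomorphism onto [J']. *)
Definition same_up_to_parametrization
    (J : R -> Prop) (x : R -> R4) (J' : R -> Prop) (y : R -> R4) : Prop :=
  exists h : R -> R,
    smooth_on J h /\
    (forall u, J u -> Derive h u <> 0) /\
    (forall t, J' t <-> exists u, J u /\ h u = t) /\
    (forall u, J u -> x u = y (h u)).

Definition log_arg1 (beta A u : R) : R := beta * u + sqrt (A + beta ^ 2 * u ^ 2).
Definition log_arg2 (beta A u : R) : R := beta * u + sqrt (beta ^ 2 * u ^ 2 - A).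

Definition profile1 (alpha beta A C eps u : R) : R :=
  sqrt A / alpha * sin (eps * (alpha / beta) * ln (Rabs (log_arg1 beta A u)) + C).

Definition profile2 (alpha beta A C eps u : R) : R :=
  sqrt A / alpha * sin (eps * (alpha / beta) * ln (Rabs (log_arg2 beta A u)) + C).

(** [sqrt] and [ln] are total in the library (with value 0 outside their
    domain), so the meaningfulness of the formulas has to be spelled out. *)
Definition profile1_defined (beta A u : R) : Prop :=
  0 <= A /\ 0 <= A + beta ^ 2 * u ^ 2 /\ log_arg1 beta A u <> 0.

Definition profile2_defined (beta A u : R) : Prop :=
  0 <= A /\ 0 <= beta ^ 2 * u ^ 2 - A /\ log_arg2 beta A u <> 0.

Definition meridian1_determined
    (alpha beta : R) (J : R -> Prop) (f g : R -> R) : Prop :=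
  exists (A C eps : R) (J' : R -> Prop),
    (eps = 1 \/ eps = -1) /\
    (forall t, J' t -> profile1_defined beta A t) /\
    same_up_to_parametrization J (meridian1 f g)
      J' (meridian1 (profile1 alpha beta A C eps) (fun t => t)).

Definition meridian2_determined
    (alpha beta : R) (J : R -> Prop) (f g : R -> R) : Prop :=
  exists (A C eps : R) (J' : R -> Prop),
    (eps = 1 \/ eps = -1) /\
    (forall t, J' t -> profile2_defined beta A t) /\
    same_up_to_parametrization J (meridian2 f g)
      J' (meridian2 (profile2 alpha beta A C eps) (fun t => t)).

(** On a surface of the second type [g'] may vanish, and near such a point the
    meridian has no parametrization [(f(u), 0, u, 0)].  This happens on minimal
    surfaces: [f = a / alpha * sin (alpha * s)], [g = a / beta * cosh (beta * s)],
    [a > 0], at [s = 0], where the branches [eps = 1] and [eps = -1] of the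
    formula meet; hence the restriction to arcs without such points. *)
Definition meridian2_determined_on_arcs
    (alpha beta : R) (J : R -> Prop) (f g : R -> R) : Prop :=
  (forall u delta, J u -> 0 < delta ->
     exists u', J u' /\ Rabs (u' - u) < delta /\ Derive g u' <> 0) /\
  (forall I : R -> Prop,
     is_interval I -> (forall u, I u -> J u) ->
     (forall u, I u -> Derive g u <> 0) ->
     meridian2_determined alpha beta I f g).

(* Main.v *)
Require Import Defs.
From Stdlib Require Import Reals Lra Classical FunctionalExtensionality.
From Coquelicot Require Import Coquelicot.
Open Scope R_scope.

(** Both surfaces have the form [(f cos, f sin, g p, g q)] with [p' = beta q],
    [q' = beta p] and [q ^ 2 - p ^ 2 = kappa], where [kappa = 1] for the first type
    and [kappa = -1] for the second one, so one computation serves both.  The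
    coordinates are orthogonal, with [E = f' ^ 2 - kappa g' ^ 2] and
    [G = alpha ^ 2 f ^ 2 + kappa beta ^ 2 g ^ 2], and timelikeness says that
    [kappa E < 0 < kappa G].  The mean curvature vector has a single component, which
    does not depend on [v] ([rotational_mean_curvature]); it vanishes iff
    [(f'' g' - g'' f') G = (alpha ^ 2 f g' + beta ^ 2 g f') E].

    This equation is the one satisfied by [f_ss = - alpha ^ 2 f],
    [g_ss = beta ^ 2 g] in an isothermal parameter [s], where [E = - G].  The energy
    [f_s ^ 2 + alpha ^ 2 f ^ 2], written in an arbitrary parameter, is therefore a
    constant [A] ([first_integral_constant]).  Then
    [g_s ^ 2 = kappa A + beta ^ 2 g ^ 2] recovers [s] from [g]: where [g' <> 0],
    [beta s = ln |beta g + sqrt (kappa A + beta ^ 2 g ^ 2)|] up to sign and a constant,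
    and the harmonic oscillation of amplitude [sqrt A / alpha] becomes the stated
    formula ([minimal_meridian_profile]).  Freedom from inflection points gives
    [A > 0]: [A = 0] would force [f = f' = 0], and such points are inflection
    points.  With [A > 0] the argument of the logarithm cannot vanish.

    Conversely the formula is differentiated twice ([profile_meridian_defect]).
    This is possible where [kappa A + beta ^ 2 g ^ 2 > 0], a dense set of parameters,
    and continuity gives the equation everywhere.  In the same way, for the second
    type, minimality on the arcs with [g' <> 0] gives minimality as soon as these arcs
    are dense, and on a minimal surface they are ([Derive_neq_0_dense]).

    The new parameter in the statements can only be [h = g], since the meridian
    [(f (u), u)] has its own coordinate as parameter. *)

(** * Functions on intervals *)

Lemma is_interval_restrict (J : R -> Prop) (u d : R) :
  is_interval J -> J u -> 0 < d ->
  is_interval (fun x => J x /\ Rabs (x - u) < d).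
Proof.
intros [Hc [a [b [Ja [Jb Hab]]]]] Ju Hd; split.
- intros x y t [Jx Hx] [Jy Hy] Ht; split; [now apply (Hc x y)|].
  apply Rabs_def2 in Hx; apply Rabs_def2 in Hy; apply Rabs_def1; lra.
- destruct (Rlt_or_le u b) as [Hub|Hub].
  + exists u, (Rmin b (u + d / 2)).
    pose proof (Rmin_l b (u + d / 2)); pose proof (Rmin_r b (u + d / 2)).
    assert (u < Rmin b (u + d / 2)) by (apply Rmin_glb_lt; lra).
    repeat split; trivial.
    * apply Rabs_def1; lra.
    * apply (Hc u b); trivial; lra.
    * apply Rabs_def1; lra.
  + exists (Rmax a (u - d / 2)), u.
    pose proof (Rmax_l a (u - d / 2)); pose proof (Rmax_r a (u - d / 2)).
    assert (Rmax a (u - d / 2) < u) by (apply Rmax_lub_lt; lra).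
    repeat split; trivial.
    * apply (Hc a u); trivial; lra.
    * apply Rabs_def1; lra.
    * apply Rabs_def1; lra.
Qed.

Lemma is_interval_near (J : R -> Prop) (u d : R) :
  is_interval J -> J u -> 0 < d ->
  exists x, J x /\ x <> u /\ Rabs (x - u) < d.
Proof.
intros HJ Ju Hd.
destruct (is_interval_restrict J u d HJ Ju Hd)
  as [_ [a [b [[Ja Ha] [[Jb Hb] Hab]]]]].
destruct (Req_dec a u) as [->|Hau]; [exists b|exists a]; repeat split; trivial; lra.
Qed.

(** Only the difference quotients along [J] enter a derivative that is already
    known to exist; this covers the endpoints of [J]. *)
Lemma is_derive_unique_on (J : R -> Prop) (p q : R -> R) (u l m : R) :
  is_interval J -> J u -> (forall x, J x -> p x = q x) ->
  is_derive p u l -> is_derive q u m -> l = m.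
Proof.
intros HJ Ju Hpq Hp Hq.
apply is_derive_Reals in Hp; apply is_derive_Reals in Hq.
destruct (Req_dec l m) as [|Hlm]; trivial; exfalso.
assert (He : 0 < Rabs (l - m) / 2).
{ assert (0 < Rabs (l - m)) by (apply Rabs_pos_lt; lra). lra. }
destruct (Hp _ He) as [d1 H1]; destruct (Hq _ He) as [d2 H2].
destruct (is_interval_near J u (Rmin d1 d2) HJ Ju) as [x [Jx [Hx Hd]]].
{ apply Rmin_glb_lt; apply cond_pos. }
specialize (H1 (x - u)); specialize (H2 (x - u)).
replace (u + (x - u)) with x in * by ring.
rewrite !Hpq in H1; trivial.
assert (A1 := H1 ltac:(lra) (Rlt_le_trans _ _ _ Hd (Rmin_l _ _))).
assert (A2 := H2 ltac:(lra) (Rlt_le_trans _ _ _ Hd (Rmin_r _ _))).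
apply Rabs_def2 in A1; apply Rabs_def2 in A2.
revert A1 A2 He; unfold Rabs; destruct (Rcase_abs (l - m)); lra.
Qed.

Lemma constant_on_interval (J : R -> Prop) (p : R -> R) :
  is_interval J -> (forall u, J u -> is_derive p u 0) ->
  forall x y, J x -> J y -> p x = p y.
Proof.
intros [Hc _] Hp.
assert (H : forall x y, J x -> J y -> x < y -> p x = p y).
{ intros x y Jx Jy Hxy; apply (eq_is_derive p); trivial.
  intros t Ht; apply Hp; now apply (Hc x y). }
intros x y Jx Jy; destruct (Rtotal_order x y) as [L|[->|L]]; auto.
symmetry; auto.
Qed.

Lemma continuous_neq_0_near (p : R -> R) (u : R) :
  continuous p u -> p u <> 0 ->
  exists d, 0 < d /\ forall x, Rabs (x - u) < d -> p x <> 0.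
Proof.
intros Hp Hu.
assert (He : 0 < Rabs (p u)) by now apply Rabs_pos_lt.
apply continuity_pt_filterlim in Hp.
destruct (Hp _ He) as [d [Hd H]].
exists d; split; trivial; intros x Hx E.
destruct (Req_dec x u) as [->|Hxu]; [easy|].
specialize (H x); simpl in H; unfold Rdist, D_x, no_cond in H.
assert (Rabs (p x - p u) < Rabs (p u)) by (apply H; repeat split; auto).
rewrite E, Rminus_0_l, Rabs_Ropp in H0; lra.
Qed.

Lemma eq_0_of_zeros_near (p : R -> R) (u : R) :
  continuous p u ->
  (forall d, 0 < d -> exists x, Rabs (x - u) < d /\ p x = 0) ->
  p u = 0.
Proof.
intros Hp H; destruct (Req_dec (p u) 0) as [|Hu]; trivial; exfalso.
destruct (continuous_neq_0_near p u Hp Hu) as [d [Hd Hn]].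
destruct (H d Hd) as [x [Hx E]]; exact (Hn x Hx E).
Qed.

Lemma smooth_on_restrict (I J : R -> Prop) (f : R -> R) :
  (forall u, I u -> J u) -> smooth_on J f -> smooth_on I f.
Proof. intros H Hf n x Ix; apply Hf; auto. Qed.

Lemma smooth_on_derive (J : R -> Prop) (f : R -> R) (u : R) :
  smooth_on J f -> J u -> is_derive f u (Derive f u).
Proof. intros Hf Ju; apply Derive_correct; exact (Hf 1%nat u Ju). Qed.

Lemma smooth_on_Derive (J : R -> Prop) (f : R -> R) :
  smooth_on J f -> smooth_on J (Derive f).
Proof.
intros Hf n x Jx.
assert (H : forall k y, Derive_n f (S k) y = Derive_n (Derive f) k y).
{ intros k; induction k as [|k IH]; intros y; [reflexivity|].
  simpl; apply Derive_ext; intros t; apply IH. }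
destruct n as [|n]; [exact I|].
simpl; apply ex_derive_ext with (Derive_n f (S n)); [intros t; apply H|].
exact (Hf (S (S n)) x Jx).
Qed.

(** * The meridian equation *)

(** [meridian_E] and [meridian_G] are the coefficients [E] and [G] of the induced
    metric, and [meridian_defect] is the numerator of the only component of the
    mean curvature vector. *)
Definition meridian_E (kappa : R) (f g : R -> R) (u : R) : R :=
  Derive f u ^ 2 - kappa * Derive g u ^ 2.

Definition meridian_G (kappa alpha beta : R) (f g : R -> R) (u : R) : R :=
  alpha ^ 2 * f u ^ 2 + kappa * beta ^ 2 * g u ^ 2.

Definition meridian_defect (kappa alpha beta : R) (f g : R -> R) (u : R) : R :=
  (Derive (Derive f) u * Derive g u - Derive (Derive g) u * Derive f u)
    * meridian_G kappa alpha beta f g u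
  - (alpha ^ 2 * f u * Derive g u + beta ^ 2 * g u * Derive f u)
    * meridian_E kappa f g u.

Definition timelike_meridian (kappa alpha beta : R) (J : R -> Prop) (f g : R -> R) :=
  forall u, J u ->
    kappa * meridian_E kappa f g u < 0 /\
    0 < kappa * meridian_G kappa alpha beta f g u.

Definition profile (kappa alpha beta A C eps t : R) : R :=
  sqrt A / alpha
  * sin (eps * (alpha / beta)
         * ln (Rabs (beta * t + sqrt (kappa * A + beta ^ 2 * t ^ 2))) + C).

Lemma is_derive_ln_Rabs (x : R) : x <> 0 -> is_derive (fun t => ln (Rabs t)) x (/ x).
Proof.
intros Hx; destruct (Rdichotomy _ _ Hx) as [H|H].
- apply is_derive_ext_loc with (fun t => ln (- t)).
  + apply (locally_interval _ x m_infty 0); simpl; trivial.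
    intros y _ Hy; now rewrite Rabs_left.
  + auto_derive; [lra|field; lra].
- apply is_derive_ext_loc with (fun t => ln t).
  + apply (locally_interval _ x 0 p_infty); simpl; trivial.
    intros y Hy _; now rewrite Rabs_right by lra.
  + auto_derive; [lra|field; lra].
Qed.

Lemma is_derive_sqrt_quadratic (c beta : R) (g : R -> R) (u g1 : R) :
  is_derive g u g1 -> 0 < c + beta ^ 2 * g u ^ 2 ->
  is_derive (fun x => sqrt (c + beta ^ 2 * g x ^ 2)) u
    (beta ^ 2 * g u * g1 / sqrt (c + beta ^ 2 * g u ^ 2)).
Proof.
intros Hg Hw.
assert (0 < sqrt (c + beta ^ 2 * g u ^ 2)) by now apply sqrt_lt_R0.
assert (Hq : is_derive (fun x => c + beta ^ 2 * g x ^ 2) u (2 * beta ^ 2 * g u * g1)).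
{ auto_derive; [eexists; exact Hg|].
  replace (Derive _ u) with g1 by (symmetry; now apply is_derive_unique); ring. }
evar_last.
- eapply (is_derive_comp sqrt (fun x => c + beta ^ 2 * g x ^ 2)); [|exact Hq].
  apply is_derive_Reals, derivable_pt_lim_sqrt, Hw.
- change scal with Rmult; simpl; field; apply Rgt_not_eq, H.
Qed.

(** If [beta g] is written as [sqrt c * sinh s] for [c > 0], or as
    [sqrt (- c) * cosh s] up to sign for [c < 0], this logarithm is [s] up to sign and
    an additive constant, and [s' ^ 2 = (beta g') ^ 2 / (c + beta ^ 2 g ^ 2)]. *)
Lemma is_derive_hyperbolic_angle (c beta : R) (g : R -> R) (u g1 : R) :
  is_derive g u g1 -> 0 < c + beta ^ 2 * g u ^ 2 ->
  beta * g u + sqrt (c + beta ^ 2 * g u ^ 2) <> 0 ->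
  is_derive (fun x => ln (Rabs (beta * g x + sqrt (c + beta ^ 2 * g x ^ 2)))) u
    (beta * g1 / sqrt (c + beta ^ 2 * g u ^ 2)).
Proof.
intros Hg Hw HL.
assert (0 < sqrt (c + beta ^ 2 * g u ^ 2)) by now apply sqrt_lt_R0.
pose proof (is_derive_sqrt_quadratic c beta g u g1 Hg Hw) as Hs.
evar_last.
- eapply (is_derive_comp (fun t => ln (Rabs t))
           (fun x => beta * g x + sqrt (c + beta ^ 2 * g x ^ 2))).
  + apply is_derive_ln_Rabs, HL.
  + apply (is_derive_plus (fun x => beta * g x)); [|exact Hs].
    apply (is_derive_scal g u beta g1 Hg).
- change scal with Rmult; change plus with Rplus; simpl; field; split; [apply Rgt_not_eq, H|exact HL].
Qed.

Lemma polar_angle (p q r : R) :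
  0 < r -> p ^ 2 + q ^ 2 = r ^ 2 -> exists C, p = r * sin C /\ q = r * cos C.
Proof.
intros Hr H.
assert (Hq : -1 <= q / r <= 1).
{ split; [apply Rle_div_r|apply Rle_div_l]; trivial; nra. }
assert (Hs : sqrt (1 - Rsqr (q / r)) = Rabs p / r).
{ replace (1 - Rsqr (q / r)) with (Rsqr (Rabs p / r)).
  - apply sqrt_Rsqr, Rdiv_le_0_compat; trivial; apply Rabs_pos.
  - unfold Rsqr; transitivity (Rabs p * Rabs p / r ^ 2); [field; lra|].
    rewrite <- Rabs_mult, Rabs_pos_eq by nra.
    replace (p * p) with (r ^ 2 - q ^ 2) by lra; field; lra. }
destruct (Rle_or_lt 0 p) as [Hp|Hp].
- exists (acos (q / r)); rewrite sin_acos, cos_acos, Hs, Rabs_pos_eq by trivial.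
  split; field; lra.
- exists (- acos (q / r)).
  rewrite sin_neg, cos_neg, sin_acos, cos_acos, Hs, Rabs_left by trivial.
  split; field; lra.
Qed.

(** The pair [(f, k)] turns with angular speed [theta'], so turning it back by
    the angle [theta] gives a constant vector. *)
Lemma rotation_system (J : R -> Prop) (f k theta theta1 : R -> R) (r : R) :
  is_interval J -> 0 < r ->
  (forall u, J u -> is_derive theta u (theta1 u)) ->
  (forall u, J u -> is_derive f u (theta1 u * k u)) ->
  (forall u, J u -> is_derive k u (- theta1 u * f u)) ->
  (forall u, J u -> f u ^ 2 + k u ^ 2 = r ^ 2) ->
  exists C, forall u, J u -> f u = r * sin (theta u + C).
Proof.
intros HJ Hr Ht Hf Hk HA.
pose (p := fun u => f u * cos (theta u) - k u * sin (theta u)).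
pose (q := fun u => f u * sin (theta u) + k u * cos (theta u)).
assert (Hpq : forall u, J u -> is_derive p u 0 /\ is_derive q u 0).
{ intros u Ju; specialize (Ht u Ju); specialize (Hf u Ju); specialize (Hk u Ju).
  unfold p, q; split; (auto_derive; [repeat split; eexists; eassumption|]);
    replace (Derive (fun x => f x) u) with (theta1 u * k u)
      by (symmetry; now apply is_derive_unique);
    replace (Derive (fun x => k x) u) with (- theta1 u * f u)
      by (symmetry; now apply is_derive_unique);
    replace (Derive (fun x => theta x) u) with (theta1 u)
      by (symmetry; now apply is_derive_unique);
    ring. }
destruct (proj2 HJ) as [a [_ [Ja _]]].
assert (trig : forall x, sin x ^ 2 + cos x ^ 2 = 1).
{ intros x; pose proof (sin2_cos2 x) as E; unfold Rsqr in E; lra. }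
destruct (polar_angle (p a) (q a) r Hr) as [C [EC1 EC2]].
{ rewrite <- (HA a Ja); unfold p, q; pose proof (trig (theta a)).
  transitivity ((f a ^ 2 + k a ^ 2) * (sin (theta a) ^ 2 + cos (theta a) ^ 2)); [ring|].
  rewrite H; ring. }
exists C; intros u Ju.
rewrite sin_plus.
transitivity (p u * cos (theta u) + q u * sin (theta u)).
{ unfold p, q; pose proof (trig (theta u)).
  transitivity (f u * (sin (theta u) ^ 2 + cos (theta u) ^ 2)); [rewrite H|]; ring. }
rewrite (constant_on_interval J p HJ (fun x Jx => proj1 (Hpq x Jx)) u a Ju Ja).
rewrite (constant_on_interval J q HJ (fun x Jx => proj2 (Hpq x Jx)) u a Ju Ja).
rewrite EC1, EC2; ring.
Qed.

(** The energy [f_s ^ 2 + alpha ^ 2 f ^ 2] with respect to an isothermal parameter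
    [s], one for which [E = - G], expressed in the given parameter. *)
Definition first_integral (kappa alpha beta : R) (f g : R -> R) (u : R) : R :=
  - kappa * (alpha ^ 2 * f u ^ 2 * Derive g u ^ 2 + beta ^ 2 * g u ^ 2 * Derive f u ^ 2)
  / meridian_E kappa f g u.

(** The derivative is [2 kappa f' g' / E ^ 2] times the defect. *)
Lemma first_integral_constant (kappa alpha beta : R) (J : R -> Prop) (f g : R -> R) :
  is_interval J -> smooth_on J f -> smooth_on J g ->
  (forall u, J u -> meridian_E kappa f g u <> 0) ->
  (forall u, J u -> meridian_defect kappa alpha beta f g u = 0) ->
  forall x y, J x -> J y ->
    first_integral kappa alpha beta f g x = first_integral kappa alpha beta f g y.
Proof.
intros HJ Hf Hg HE Heq; apply constant_on_interval; trivial.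
intros u Ju.
pose proof (smooth_on_derive J f u Hf Ju) as F1.
pose proof (smooth_on_derive J g u Hg Ju) as G1.
pose proof (smooth_on_derive J _ u (smooth_on_Derive J f Hf) Ju) as F2.
pose proof (smooth_on_derive J _ u (smooth_on_Derive J g Hg) Ju) as G2.
specialize (HE u Ju); specialize (Heq u Ju).
unfold meridian_defect, meridian_G, meridian_E in *.
unfold first_integral, meridian_E.
pose (f1 := Derive f); pose (g1 := Derive g).
fold f1 g1 in F1, G1, F2, G2, HE, Heq |- *.
auto_derive.
- repeat split; try (eexists; eassumption); simpl in HE; lra.
- replace (Derive (fun x => f x) u) with (f1 u) by reflexivity.
  replace (Derive (fun x => g x) u) with (g1 u) by reflexivity.
  replace (Derive (fun x => f1 x) u) with (Derive f1 u) by reflexivity.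
  replace (Derive (fun x => g1 x) u) with (Derive g1 u) by reflexivity.
  transitivity (2 * kappa * f1 u * g1 u
    * ((Derive f1 u * g1 u - Derive g1 u * f1 u) * (alpha ^ 2 * f u ^ 2 + kappa * beta ^ 2 * g u ^ 2)
       - (alpha ^ 2 * f u * g1 u + beta ^ 2 * g u * f1 u)
         * (f1 u ^ 2 - kappa * g1 u ^ 2))
    / (f1 u ^ 2 - kappa * g1 u ^ 2) ^ 2).
  + field; simpl in HE; lra.
  + rewrite Heq; field; lra.
Qed.

(** With [A] the value of the first integral, [w ^ 2 = kappa A + beta ^ 2 g ^ 2] and
    [k = f' w / (alpha g')], the equation says that [(f, k)] turns with the angular
    speed [theta' = alpha g' / w]; this is [f_ss = - alpha ^ 2 f] with
    [theta = alpha s].  The turning angle is integrated in closed form by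
    [is_derive_hyperbolic_angle]. *)
Lemma minimal_meridian_profile (kappa alpha beta : R) (J : R -> Prop) (f g : R -> R) :
  kappa ^ 2 = 1 -> 0 < alpha -> 0 < beta ->
  is_interval J -> smooth_on J f -> smooth_on J g ->
  timelike_meridian kappa alpha beta J f g ->
  (forall u, J u -> Derive g u <> 0) ->
  (forall u, J u -> ~ (f u = 0 /\ Derive f u = 0)) ->
  (forall u, J u -> meridian_defect kappa alpha beta f g u = 0) ->
  exists A C, 0 < A /\
    forall u, J u ->
      0 < kappa * A + beta ^ 2 * g u ^ 2 /\
      beta * g u + sqrt (kappa * A + beta ^ 2 * g u ^ 2) <> 0 /\
      f u = profile kappa alpha beta A C 1 (g u).
Proof.
intros Hk Ha Hb HJ Hf Hg Htl Hg1 Hinf Heq.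
destruct (proj2 HJ) as [a [_ [Ja _]]].
pose (A := first_integral kappa alpha beta f g a).
assert (HE : forall u, J u -> meridian_E kappa f g u <> 0).
{ intros u Ju E; destruct (Htl u Ju) as [H _]; rewrite E in H; lra. }
assert (HAE : forall u, J u -> A * meridian_E kappa f g u =
  - kappa * (alpha ^ 2 * f u ^ 2 * Derive g u ^ 2 + beta ^ 2 * g u ^ 2 * Derive f u ^ 2)).
{ intros u Ju; unfold A.
  rewrite (first_integral_constant kappa alpha beta J f g HJ Hf Hg HE Heq a u Ja Ju).
  unfold first_integral; field; now apply HE. }
assert (HA : 0 < A).
{ destruct (Htl a Ja) as [HEa HGa].
  assert (HN : 0 < alpha ^ 2 * f a ^ 2 * Derive g a ^ 2 + beta ^ 2 * g a ^ 2 * Derive f a ^ 2).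
  { pose proof (pow_lt alpha 2 Ha); pose proof (pow_lt beta 2 Hb).
    assert (0 < Derive g a ^ 2) by (apply pow2_gt_0; now apply Hg1).
    pose proof (pow2_ge_0 (g a)); pose proof (pow2_ge_0 (Derive f a)).
    assert (0 <= beta ^ 2 * g a ^ 2 * Derive f a ^ 2)
      by (apply Rmult_le_pos; [apply Rmult_le_pos|]; lra).
    destruct (Req_dec (f a) 0) as [f0|f0].
    - assert (g a <> 0).
      { intros g0; unfold meridian_G in HGa; rewrite f0, g0 in HGa; lra. }
      assert (Derive f a <> 0) by (intros f1; now apply (Hinf a Ja)).
      assert (0 < g a ^ 2) by now apply pow2_gt_0.
      assert (0 < Derive f a ^ 2) by now apply pow2_gt_0.
      assert (0 < beta ^ 2 * g a ^ 2 * Derive f a ^ 2)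
        by (apply Rmult_lt_0_compat; [apply Rmult_lt_0_compat|]; lra).
      rewrite f0; lra.
    - assert (0 < f a ^ 2) by now apply pow2_gt_0.
      assert (0 < alpha ^ 2 * f a ^ 2 * Derive g a ^ 2)
        by (apply Rmult_lt_0_compat; [apply Rmult_lt_0_compat|]; lra).
      lra. }
  specialize (HAE a Ja).
  apply Rmult_lt_reg_r with (- (kappa * meridian_E kappa f g a)); [lra|].
  rewrite Rmult_0_l.
  replace (A * - (kappa * meridian_E kappa f g a))
    with (- kappa * (A * meridian_E kappa f g a)) by ring.
  rewrite HAE.
  replace (- kappa * (- kappa * _)) with
    (kappa ^ 2 * (alpha ^ 2 * f a ^ 2 * Derive g a ^ 2
                  + beta ^ 2 * g a ^ 2 * Derive f a ^ 2)) by ring.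
  rewrite Hk; lra. }
(* As [kappa E < 0 < kappa G], this identity makes [w ^ 2] positive. *)
assert (HwE : forall u, J u ->
  (kappa * A + beta ^ 2 * g u ^ 2) * meridian_E kappa f g u
  = - Derive g u ^ 2 * meridian_G kappa alpha beta f g u).
{ intros u Ju; specialize (HAE u Ju).
  transitivity (kappa * (A * meridian_E kappa f g u)
                + beta ^ 2 * g u ^ 2 * meridian_E kappa f g u); [ring|].
  rewrite HAE; unfold meridian_E, meridian_G.
  replace (kappa * (- kappa * _)) with
    (- kappa ^ 2 * (alpha ^ 2 * f u ^ 2 * Derive g u ^ 2
                  + beta ^ 2 * g u ^ 2 * Derive f u ^ 2)) by ring.
  rewrite Hk; ring. }
assert (Hw : forall u, J u -> 0 < kappa * A + beta ^ 2 * g u ^ 2).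
{ intros u Ju; specialize (HwE u Ju); destruct (Htl u Ju) as [HEu HGu].
  assert (0 < Derive g u ^ 2) by (apply pow2_gt_0; now apply Hg1).
  apply Rmult_lt_reg_r with (- (kappa * meridian_E kappa f g u)); [lra|].
  rewrite Rmult_0_l.
  replace (_ * - (kappa * meridian_E kappa f g u)) with
    (- kappa * ((kappa * A + beta ^ 2 * g u ^ 2) * meridian_E kappa f g u)) by ring.
  rewrite HwE.
  replace (- kappa * _) with (Derive g u ^ 2 * (kappa * meridian_G kappa alpha beta f g u))
    by ring.
  now apply Rmult_lt_0_compat. }
(* A zero would give [w ^ 2 = beta ^ 2 g ^ 2], hence [kappa A = 0]. *)
assert (HL : forall u, J u -> beta * g u + sqrt (kappa * A + beta ^ 2 * g u ^ 2) <> 0).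
{ intros u Ju E; specialize (Hw u Ju).
  pose proof (pow2_sqrt _ (Rlt_le _ _ Hw)) as E2.
  replace (sqrt (kappa * A + beta ^ 2 * g u ^ 2)) with (- (beta * g u)) in E2 by lra.
  assert (kappa * A = 0) by lra.
  assert (A * kappa ^ 2 = 0) by (replace (A * kappa ^ 2) with (kappa * (kappa * A)) by ring; rewrite H; ring).
  rewrite Hk in H0; lra. }
pose (w := fun u => sqrt (kappa * A + beta ^ 2 * g u ^ 2)).
assert (Hw0 : forall u, J u -> 0 < w u) by (intros u Ju; apply sqrt_lt_R0; auto).
assert (Hw2 : forall u, J u -> w u ^ 2 = kappa * A + beta ^ 2 * g u ^ 2)
  by (intros u Ju; apply pow2_sqrt, Rlt_le; auto).
destruct (rotation_system J f (fun u => Derive f u * w u / (alpha * Derive g u))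
  (fun u => 1 * (alpha / beta) * ln (Rabs (beta * g u + w u)))
  (fun u => alpha * Derive g u / w u) (sqrt A / alpha)) as [C HC]; trivial.
- apply Rdiv_lt_0_compat; trivial; now apply sqrt_lt_R0.
- intros u Ju.
  evar_last; [apply is_derive_scal, (is_derive_hyperbolic_angle _ beta g u (Derive g u))|].
  + now apply (smooth_on_derive J).
  + auto.
  + auto.
  + specialize (Hw0 u Ju); fold (w u); field; lra.
- intros u Ju; specialize (Hw0 u Ju); specialize (Hg1 u Ju).
  evar_last; [now apply (smooth_on_derive J)|field; repeat split; lra].
- intros u Ju.
  pose proof (smooth_on_derive J g u Hg Ju) as G1.
  pose proof (smooth_on_derive J _ u (smooth_on_Derive J f Hf) Ju) as F2.
  pose proof (smooth_on_derive J _ u (smooth_on_Derive J g Hg) Ju) as G2.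
  pose proof (is_derive_sqrt_quadratic _ beta g u _ G1 (Hw u Ju)) as W1.
  change (is_derive w u (beta ^ 2 * g u * Derive g u / w u)) in W1.
  specialize (Hw0 u Ju); specialize (Hg1 u Ju); specialize (HE u Ju).
  specialize (Heq u Ju); specialize (HwE u Ju); rewrite <- Hw2 in HwE by trivial.
  assert (K : (Derive (Derive f) u * Derive g u - Derive (Derive g) u * Derive f u) * w u ^ 2
     = - Derive g u ^ 2 * (alpha ^ 2 * f u * Derive g u + beta ^ 2 * g u * Derive f u)).
  { apply Rmult_eq_reg_r with (meridian_E kappa f g u); trivial.
    rewrite Rmult_assoc, HwE; unfold meridian_defect in Heq.
    replace ((Derive (Derive f) u * Derive g u - Derive (Derive g) u * Derive f u)
      * (- Derive g u ^ 2 * meridian_G kappa alpha beta f g u)) with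
      (- Derive g u ^ 2 * ((Derive (Derive f) u * Derive g u - Derive (Derive g) u * Derive f u)
      * meridian_G kappa alpha beta f g u)) by ring.
    replace ((Derive (Derive f) u * Derive g u - Derive (Derive g) u * Derive f u)
      * meridian_G kappa alpha beta f g u) with
      ((alpha ^ 2 * f u * Derive g u + beta ^ 2 * g u * Derive f u)
       * meridian_E kappa f g u) by lra.
    ring. }
  pose (f1 := Derive f); pose (g1 := Derive g).
  fold f1 g1 in G1, F2, G2, W1, K, Hg1 |- *.
  auto_derive.
  + repeat split; try (eexists; eassumption); apply Rmult_integral_contrapositive; lra.
  + replace (Derive (fun x => w x) u) with (beta ^ 2 * g u * g1 u / w u)
      by (symmetry; now apply is_derive_unique).
    replace (Derive (fun x => f1 x) u) with (Derive f1 u) by reflexivity.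
    replace (Derive (fun x => g1 x) u) with (Derive g1 u) by reflexivity.
    transitivity (((Derive f1 u * g1 u - Derive g1 u * f1 u) * w u ^ 2
      + beta ^ 2 * g u * g1 u ^ 2 * f1 u) / (alpha * g1 u ^ 2 * w u)).
    * field; repeat split; lra.
    * rewrite K; field; repeat split; lra.
- intros u Ju; specialize (Hw0 u Ju); specialize (Hg1 u Ju); specialize (HE u Ju).
  specialize (HwE u Ju); rewrite <- Hw2 in HwE by trivial; specialize (HAE u Ju).
  replace ((sqrt A / alpha) ^ 2) with (A / alpha ^ 2)
    by (rewrite <- (pow2_sqrt A) at 1 by lra; field; lra).
  replace ((Derive f u * w u / (alpha * Derive g u)) ^ 2) with
    (Derive f u ^ 2 * w u ^ 2 / (alpha ^ 2 * Derive g u ^ 2))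
    by (field; split; lra).
  replace (w u ^ 2) with (- Derive g u ^ 2 * meridian_G kappa alpha beta f g u
    / meridian_E kappa f g u) by (rewrite <- HwE; field; lra).
  replace A with (A * meridian_E kappa f g u / meridian_E kappa f g u) by (field; lra).
  rewrite HAE; revert HE; unfold meridian_E, meridian_G; intros HE.
  field; repeat split; simpl in HE; lra.
- exists A, C; split; trivial; intros u Ju; repeat split; auto.
Qed.

(** One differentiation of the formula gives [f' w = eps sqrt A cos theta g'] with
    [w ^ 2 = kappa A + beta ^ 2 g ^ 2], and a second one, applied to this product to
    avoid quotients, gives [f'' g' - g'' f'].  The identity [w ^ 2 E = - g' ^ 2 G]
    then removes [A]. *)
Lemma profile_meridian_defect_regular
    (kappa alpha beta A C eps : R) (J : R -> Prop) (f g : R -> R) :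
  kappa ^ 2 = 1 -> 0 < alpha -> 0 < beta -> 0 <= A -> eps ^ 2 = 1 ->
  is_interval J -> smooth_on J f -> smooth_on J g ->
  (forall u, J u -> Derive g u <> 0) ->
  (forall u, J u ->
      0 < kappa * A + beta ^ 2 * g u ^ 2 /\
      beta * g u + sqrt (kappa * A + beta ^ 2 * g u ^ 2) <> 0 /\
      f u = profile kappa alpha beta A C eps (g u)) ->
  forall u, J u -> meridian_defect kappa alpha beta f g u = 0.
Proof.
intros Hk Ha Hb HA He HJ Hf Hg Hg1 Hp.
pose (w := fun u => sqrt (kappa * A + beta ^ 2 * g u ^ 2)).
pose (theta := fun u => eps * (alpha / beta) * ln (Rabs (beta * g u + w u)) + C).
assert (Hw0 : forall u, J u -> 0 < w u) by (intros u Ju; now apply sqrt_lt_R0, Hp).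
assert (Hw2 : forall u, J u -> w u ^ 2 = kappa * A + beta ^ 2 * g u ^ 2)
  by (intros u Ju; now apply pow2_sqrt, Rlt_le, Hp).
assert (Ht : forall u, J u -> is_derive theta u (eps * alpha * Derive g u / w u)).
{ intros u Ju; destruct (Hp u Ju) as [P1 [P2 _]]; specialize (Hw0 u Ju).
  unfold theta; evar_last.
  - apply (is_derive_plus (fun u => eps * (alpha / beta) * ln (Rabs (beta * g u + w u)))
      (fun _ => C)); [|apply is_derive_const].
    apply is_derive_scal, is_derive_hyperbolic_angle; trivial.
    now apply (smooth_on_derive J).
  - fold (w u); change plus with Rplus; change zero with 0; field; lra. }
assert (Hfe : forall u, J u -> f u = sqrt A / alpha * sin (theta u))
  by (intros u Ju; now apply Hp).
assert (Hf1 : forall u, J u -> Derive f u * w u = eps * sqrt A * cos (theta u) * Derive g u).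
{ intros u Ju; specialize (Hw0 u Ju).
  rewrite (is_derive_unique_on J f (fun u => sqrt A / alpha * sin (theta u)) u
    (Derive f u) (eps * sqrt A * cos (theta u) * Derive g u / w u)); trivial.
  - field; lra.
  - now apply (smooth_on_derive J).
  - specialize (Ht u Ju); auto_derive; [eexists; eassumption|].
    replace (Derive (fun x => theta x) u) with (eps * alpha * Derive g u / w u)
      by (symmetry; now apply is_derive_unique).
    field; lra. }
intros u Ju.
pose proof (smooth_on_derive J g u Hg Ju) as G1.
pose proof (smooth_on_derive J _ u (smooth_on_Derive J f Hf) Ju) as F2.
pose proof (smooth_on_derive J _ u (smooth_on_Derive J g Hg) Ju) as G2.
assert (W1 : is_derive w u (beta ^ 2 * g u * Derive g u / w u))
  by now apply is_derive_sqrt_quadratic, Hp.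
specialize (Ht u Ju); pose proof (Hw0 u Ju) as Hwu; pose proof (Hg1 u Ju) as Hgu.
assert (K : Derive (Derive f) u * w u + Derive f u * (beta ^ 2 * g u * Derive g u / w u)
  = eps * sqrt A * (- sin (theta u) * (eps * alpha * Derive g u / w u) * Derive g u
                    + cos (theta u) * Derive (Derive g) u)).
{ pose (f1 := Derive f); pose (g1 := Derive g).
  fold f1 g1 in Hf1, G1, F2, G2, W1, Ht |- *.
  apply (is_derive_unique_on J (fun u => f1 u * w u)
    (fun u => eps * sqrt A * cos (theta u) * g1 u) u); trivial.
  - auto_derive; [repeat split; eexists; eassumption|].
    replace (Derive (fun x => w x) u) with (beta ^ 2 * g u * g1 u / w u)
      by (symmetry; now apply is_derive_unique).
    replace (Derive (fun x => f1 x) u) with (Derive f1 u) by reflexivity.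
    ring.
  - auto_derive; [repeat split; eexists; eassumption|].
    replace (Derive (fun x => theta x) u) with (eps * alpha * g1 u / w u)
      by (symmetry; now apply is_derive_unique).
    replace (Derive (fun x => g1 x) u) with (Derive g1 u) by reflexivity.
    ring. }
specialize (Hf1 u Ju); specialize (Hfe u Ju); specialize (Hw2 u Ju).
assert (K2 : (Derive (Derive f) u * Derive g u - Derive (Derive g) u * Derive f u) * w u ^ 2
     = - Derive g u ^ 2 * (alpha ^ 2 * f u * Derive g u + beta ^ 2 * g u * Derive f u)).
{ transitivity (w u * Derive g u * (Derive (Derive f) u * w u
      + Derive f u * (beta ^ 2 * g u * Derive g u / w u))
    - Derive f u * w u * w u * Derive (Derive g) u
    - beta ^ 2 * g u * Derive f u * Derive g u ^ 2); [field; lra|].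
  rewrite K, Hf1, Hfe.
  transitivity (- eps ^ 2 * sqrt A * alpha * sin (theta u) * Derive g u ^ 3
     - beta ^ 2 * g u * Derive f u * Derive g u ^ 2); [field; lra|].
  rewrite He; field; lra. }
assert (K3 : w u ^ 2 * meridian_E kappa f g u
  = - Derive g u ^ 2 * meridian_G kappa alpha beta f g u).
{ assert (T : sin (theta u) ^ 2 + cos (theta u) ^ 2 = 1)
    by (pose proof (sin2_cos2 (theta u)) as E; unfold Rsqr in E; lra).
  pose proof (pow2_sqrt A HA) as SA.
  unfold meridian_E, meridian_G.
  transitivity ((Derive f u * w u) ^ 2 - kappa * w u ^ 2 * Derive g u ^ 2); [ring|].
  rewrite Hf1, Hw2, Hfe.
  transitivity (eps ^ 2 * sqrt A ^ 2 * cos (theta u) ^ 2 * Derive g u ^ 2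
    - kappa ^ 2 * A * Derive g u ^ 2 - kappa * beta ^ 2 * g u ^ 2 * Derive g u ^ 2); [ring|].
  transitivity (- Derive g u ^ 2 * (sqrt A ^ 2 * sin (theta u) ^ 2
    + kappa * beta ^ 2 * g u ^ 2)); [|field; lra].
  rewrite He, Hk, SA.
  replace (cos (theta u) ^ 2) with (1 - sin (theta u) ^ 2) by lra; ring. }
apply Rmult_eq_reg_r with (w u ^ 2 * Derive g u ^ 2).
2:{ apply Rmult_integral_contrapositive; split; apply pow_nonzero; lra. }
unfold meridian_defect; rewrite Rmult_0_l.
transitivity (((Derive (Derive f) u * Derive g u - Derive (Derive g) u * Derive f u) * w u ^ 2)
    * (Derive g u ^ 2 * meridian_G kappa alpha beta f g u)
  - (alpha ^ 2 * f u * Derive g u + beta ^ 2 * g u * Derive f u) * Derive g u ^ 2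
    * (w u ^ 2 * meridian_E kappa f g u)); [ring|].
rewrite K2, K3; ring.
Qed.

Lemma continuous_meridian_defect (kappa alpha beta : R) (J : R -> Prop) (f g : R -> R) (u : R) :
  smooth_on J f -> smooth_on J g -> J u ->
  continuous (meridian_defect kappa alpha beta f g) u.
Proof.
intros Hf Hg Ju.
pose proof (smooth_on_derive J f u Hf Ju) as F1.
pose proof (smooth_on_derive J g u Hg Ju) as G1.
apply smooth_on_Derive in Hf; apply smooth_on_Derive in Hg.
pose proof (smooth_on_derive J _ u Hf Ju) as F2.
pose proof (smooth_on_derive J _ u Hg Ju) as G2.
apply smooth_on_Derive in Hf; apply smooth_on_Derive in Hg.
pose proof (smooth_on_derive J _ u Hf Ju) as F3.
pose proof (smooth_on_derive J _ u Hg Ju) as G3.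
apply (ex_derive_continuous (meridian_defect kappa alpha beta f g) u).
unfold meridian_defect, meridian_E, meridian_G.
set (f2 := Derive (Derive f)) in *; set (g2 := Derive (Derive g)) in *.
set (f1 := Derive f) in *; set (g1 := Derive g) in *.
auto_derive; repeat split; eexists; eassumption.
Qed.

(** The square root is not differentiable where [kappa A + beta ^ 2 g ^ 2 = 0].
    There [g <> 0], because the argument of the logarithm does not vanish, so with
    [g' <> 0] the complementary set of parameters is dense and the equation
    extends by continuity. *)
Lemma profile_meridian_defect
    (kappa alpha beta A C eps : R) (J : R -> Prop) (f g : R -> R) :
  kappa ^ 2 = 1 -> 0 < alpha -> 0 < beta -> 0 <= A -> eps ^ 2 = 1 ->
  is_interval J -> smooth_on J f -> smooth_on J g ->
  (forall u, J u -> Derive g u <> 0) ->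
  (forall u, J u ->
      0 <= kappa * A + beta ^ 2 * g u ^ 2 /\
      beta * g u + sqrt (kappa * A + beta ^ 2 * g u ^ 2) <> 0 /\
      f u = profile kappa alpha beta A C eps (g u)) ->
  forall u, J u -> meridian_defect kappa alpha beta f g u = 0.
Proof.
intros Hk Ha Hb HA He HJ Hf Hg Hg1 Hp u Ju.
apply eq_0_of_zeros_near; [now apply continuous_meridian_defect with J|].
intros d Hd.
pose (w2 := fun x => kappa * A + beta ^ 2 * g x ^ 2).
assert (D : forall x, J x -> is_derive w2 x (2 * beta ^ 2 * g x * Derive g x)).
{ intros x Jx; pose proof (smooth_on_derive J g x Hg Jx) as G1; unfold w2.
  auto_derive; [eexists; exact G1|].
  replace (Derive (fun x => g x) x) with (Derive g x) by reflexivity; ring. }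
pose proof (is_interval_restrict J u d HJ Ju Hd) as HI.
assert (Hex : exists x, (J x /\ Rabs (x - u) < d) /\ w2 x <> 0).
{ apply NNPP; intros N.
  assert (Z : forall x, J x /\ Rabs (x - u) < d -> w2 x = 0).
  { intros x Hx; apply NNPP; intros Hn; apply N; now exists x. }
  assert (Iu : J u /\ Rabs (u - u) < d) by (rewrite Rminus_diag, Rabs_R0; auto).
  assert (E : 2 * beta ^ 2 * g u * Derive g u = 0).
  { apply (is_derive_unique_on _ w2 (fun _ => 0) u _ _ HI Iu Z (D u Ju)).
    apply (is_derive_const 0). }
  assert (g0 : g u = 0).
  { pose proof (pow_lt beta 2 Hb); specialize (Hg1 u Ju).
    apply Rmult_integral in E as [E|E]; [|easy].
    apply Rmult_integral in E as [E|E]; [lra|easy]. }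
  destruct (Hp u Ju) as [_ [HL _]]; specialize (Z u Iu); unfold w2 in Z.
  apply HL; rewrite Z, g0, sqrt_0; ring. }
destruct Hex as [x [Ix Hx]].
destruct (continuous_neq_0_near w2 x) as [d' [Hd' Hn]]; trivial.
{ apply (ex_derive_continuous w2); eexists; now apply D. }
exists x; split; [apply Ix|].
apply (profile_meridian_defect_regular kappa alpha beta A C eps
  (fun t => (J t /\ Rabs (t - u) < d) /\ Rabs (t - x) < d') f g); trivial.
- now apply (is_interval_restrict (fun t => J t /\ Rabs (t - u) < d)).
- now apply smooth_on_restrict with J.
- now apply smooth_on_restrict with J.
- intros t Ht; now apply Hg1.
- intros t [[Jt _] Ht]; destruct (Hp t Jt) as [P1 [P2 P3]]; repeat split; trivial.
  specialize (Hn t Ht); unfold w2 in Hn; lra.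
- split; trivial; rewrite Rminus_diag, Rabs_R0; trivial.
Qed.

(** If [g' = 0] along an arc, the equation reduces to [beta ^ 2 g f' ^ 3 = 0] there,
    so that [f' = 0] too and the meridian is not regular. *)
Lemma Derive_neq_0_dense (kappa alpha beta : R) (J : R -> Prop) (f g : R -> R) :
  0 < beta -> is_interval J -> smooth_on J g ->
  timelike_meridian kappa alpha beta J f g ->
  (forall u, J u -> g u <> 0) ->
  (forall u, J u -> meridian_defect kappa alpha beta f g u = 0) ->
  forall u d, J u -> 0 < d ->
    exists x, J x /\ Rabs (x - u) < d /\ Derive g x <> 0.
Proof.
intros Hb HJ Hg Htl Hg0 Heq u d Ju Hd.
apply NNPP; intros N.
pose proof (is_interval_restrict J u d HJ Ju Hd) as HI.
assert (Z : forall x, J x /\ Rabs (x - u) < d -> Derive g x = 0).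
{ intros x [Jx Hx]; apply NNPP; intros Hn; apply N; now exists x. }
assert (Iu : J u /\ Rabs (u - u) < d) by (rewrite Rminus_diag, Rabs_R0; auto).
assert (g2 : Derive (Derive g) u = 0).
{ apply (is_derive_unique_on _ (Derive g) (fun _ => 0) u _ _ HI Iu Z).
  - now apply (smooth_on_derive J); [apply smooth_on_Derive|].
  - apply (is_derive_const 0). }
pose proof (Z u Iu) as g1; specialize (Heq u Ju); destruct (Htl u Ju) as [HE _].
specialize (Hg0 u Ju).
unfold meridian_defect, meridian_E in *; rewrite g1, g2 in *.
assert (H : beta ^ 2 * g u * Derive f u ^ 3 = 0) by lra.
pose proof (pow_lt beta 2 Hb).
assert (f1 : Derive f u = 0).
{ apply NNPP; intros f1; revert H.
  apply Rmult_integral_contrapositive; split; [|now apply pow_nonzero].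
  apply Rmult_integral_contrapositive; split; [lra|easy]. }
rewrite f1 in HE; lra.
Qed.

(** * Curvature of the rotational surfaces *)

(** [(p, q)] is [(sinh, cosh)] for [kappa = 1] and [(cosh, sinh)] for
    [kappa = -1]. *)
Definition hyperbolic_pair (kappa beta : R) (p q : R -> R) : Prop :=
  forall v, is_derive p v (beta * q v) /\ is_derive q v (beta * p v) /\
            q v ^ 2 - p v ^ 2 = kappa.

Definition rotational (alpha : R) (p q f g : R -> R) (u v : R) : R4 :=
  (f u * cos (alpha * v), f u * sin (alpha * v), g u * p v, g u * q v).

Lemma rotational_d_u (alpha : R) (p q f g : R -> R) :
  d_u (rotational alpha p q f g) = rotational alpha p q (Derive f) (Derive g).
Proof.
apply functional_extensionality; intros u; apply functional_extensionality; intros v.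
unfold d_u, Derive4, rotational; simpl.
now rewrite !Derive_scal_l.
Qed.

Lemma rotational_d_v (kappa alpha beta : R) (p q f g : R -> R) :
  hyperbolic_pair kappa beta p q ->
  d_v (rotational alpha p q f g) = fun u v =>
    (- alpha * f u * sin (alpha * v), alpha * f u * cos (alpha * v),
     beta * g u * q v, beta * g u * p v).
Proof.
intros H.
apply functional_extensionality; intros u; apply functional_extensionality; intros v.
destruct (H v) as [Hp [Hq _]].
unfold d_v, Derive4, rotational; simpl.
repeat f_equal; apply is_derive_unique.
- auto_derive; [trivial|ring].
- auto_derive; [trivial|ring].
- evar_last; [apply (is_derive_scal p v (g u)), Hp|simpl; ring].
- evar_last; [apply (is_derive_scal q v (g u)), Hq|simpl; ring].
Qed.

Lemma rotational_z_vv (kappa alpha beta : R) (p q f g : R -> R) (u v : R) :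
  hyperbolic_pair kappa beta p q ->
  z_vv (rotational alpha p q f g) u v =
    (- alpha ^ 2 * f u * cos (alpha * v), - alpha ^ 2 * f u * sin (alpha * v),
     beta ^ 2 * g u * p v, beta ^ 2 * g u * q v).
Proof.
intros H; unfold z_vv; rewrite (rotational_d_v kappa alpha beta p q f g H).
destruct (H v) as [Hp [Hq _]].
unfold d_v, Derive4; simpl.
repeat f_equal; apply is_derive_unique.
- auto_derive; [trivial|ring].
- auto_derive; [trivial|ring].
- evar_last; [apply (is_derive_scal q v (beta * g u)), Hq|simpl; ring].
- evar_last; [apply (is_derive_scal p v (beta * g u)), Hp|simpl; ring].
Qed.

Lemma R4_eq (x1 x2 x3 x4 y1 y2 y3 y4 : R) :
  x1 = y1 -> x2 = y2 -> x3 = y3 -> x4 = y4 ->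
  (x1, x2, x3, x4) = (y1, y2, y3, y4) :> R4.
Proof. now intros -> -> -> ->. Qed.

Lemma R4_plus (x1 x2 x3 x4 y1 y2 y3 y4 : R) :
  plus ((x1, x2, x3, x4) : R4) (y1, y2, y3, y4) = (x1 + y1, x2 + y2, x3 + y3, x4 + y4).
Proof. reflexivity. Qed.

Lemma R4_minus (x1 x2 x3 x4 y1 y2 y3 y4 : R) :
  minus ((x1, x2, x3, x4) : R4) (y1, y2, y3, y4) = (x1 - y1, x2 - y2, x3 - y3, x4 - y4).
Proof. reflexivity. Qed.

Lemma R4_scal (a x1 x2 x3 x4 : R) :
  scal a ((x1, x2, x3, x4) : R4) = (a * x1, a * x2, a * x3, a * x4).
Proof. reflexivity. Qed.

(** The normal components of [z_uu] and [z_vv] are both multiples of the normal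
    vector [(kappa g' cos, kappa g' sin, f' p, f' q)], and [F = 0] removes
    [z_uv] from the trace. *)
Lemma rotational_mean_curvature (kappa alpha beta : R) (p q f g : R -> R) (u v : R) :
  hyperbolic_pair kappa beta p q ->
  meridian_E kappa f g u <> 0 -> meridian_G kappa alpha beta f g u <> 0 ->
  let c := - meridian_defect kappa alpha beta f g u
           / (2 * meridian_E kappa f g u ^ 2 * meridian_G kappa alpha beta f g u) in
  mean_curvature (rotational alpha p q f g) u v =
    (c * (kappa * Derive g u * cos (alpha * v)),
     c * (kappa * Derive g u * sin (alpha * v)),
     c * (Derive f u * p v), c * (Derive f u * q v)).
Proof.
intros H HE HG; simpl.
assert (T : sin (alpha * v) ^ 2 + cos (alpha * v) ^ 2 = 1)
  by (pose proof (sin2_cos2 (alpha * v)) as E; unfold Rsqr in E; lra).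
destruct (H v) as [_ [_ Hpq]].
set (z := rotational alpha p q f g).
set (E := meridian_E kappa f g u) in *; set (G := meridian_G kappa alpha beta f g u) in *.
assert (Zu : d_u z u v = rotational alpha p q (Derive f) (Derive g) u v)
  by (unfold z; now rewrite rotational_d_u).
assert (Zv : d_v z u v = (- alpha * f u * sin (alpha * v), alpha * f u * cos (alpha * v),
     beta * g u * q v, beta * g u * p v))
  by (unfold z; now rewrite (rotational_d_v kappa alpha beta)).
assert (Zuu : z_uu z u v =
    rotational alpha p q (Derive (Derive f)) (Derive (Derive g)) u v)
  by (unfold z_uu, z; now rewrite !rotational_d_u).
pose proof (rotational_z_vv kappa alpha beta p q f g u v H) as Zvv; fold z in Zvv.
unfold rotational in Zu, Zuu.
assert (eE : ffE z u v = E).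
{ unfold ffE; rewrite Zu; unfold E, meridian_E; simpl mdot.
  transitivity (Derive f u ^ 2 * (sin (alpha * v) ^ 2 + cos (alpha * v) ^ 2)
    - Derive g u ^ 2 * (q v ^ 2 - p v ^ 2)); [ring|rewrite T, Hpq; ring]. }
assert (eF : ffF z u v = 0) by (unfold ffF; rewrite Zu, Zv; simpl mdot; ring).
assert (eG : ffG z u v = G).
{ unfold ffG; rewrite Zv; unfold G, meridian_G; simpl mdot.
  transitivity (alpha ^ 2 * f u ^ 2 * (sin (alpha * v) ^ 2 + cos (alpha * v) ^ 2)
    + beta ^ 2 * g u ^ 2 * (q v ^ 2 - p v ^ 2)); [ring|rewrite T, Hpq; ring]. }
assert (uu_u : mdot (z_uu z u v) (d_u z u v) =
  Derive (Derive f) u * Derive f u - kappa * Derive (Derive g) u * Derive g u).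
{ rewrite Zuu, Zu; simpl mdot.
  transitivity (Derive (Derive f) u * Derive f u * (sin (alpha * v) ^ 2 + cos (alpha * v) ^ 2)
    - Derive (Derive g) u * Derive g u * (q v ^ 2 - p v ^ 2)); [ring|rewrite T, Hpq; ring]. }
assert (uu_v : mdot (z_uu z u v) (d_v z u v) = 0)
  by (rewrite Zuu, Zv; simpl mdot; ring).
assert (vv_u : mdot (z_vv z u v) (d_u z u v) =
  - alpha ^ 2 * f u * Derive f u - kappa * beta ^ 2 * g u * Derive g u).
{ rewrite Zvv, Zu; simpl mdot.
  transitivity (- alpha ^ 2 * f u * Derive f u * (sin (alpha * v) ^ 2 + cos (alpha * v) ^ 2)
    - beta ^ 2 * g u * Derive g u * (q v ^ 2 - p v ^ 2)); [ring|rewrite T, Hpq; ring]. }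
assert (vv_v : mdot (z_vv z u v) (d_v z u v) = 0)
  by (rewrite Zvv, Zv; simpl mdot; ring).
unfold mean_curvature, tr_sigma, sigma_uu, sigma_vv, normal_part, tangential_part, ffdet.
rewrite eE, eF, eG, uu_u, uu_v, vv_u, vv_v.
destruct (sigma_uv z u v) as [[[s1 s2] s3] s4].
rewrite Zuu, Zvv, Zu, Zv.
unfold meridian_defect; fold E G.
unfold E, G, meridian_E, meridian_G in *.
rewrite !R4_scal, !R4_plus, !R4_minus, !R4_scal, !R4_plus, !R4_scal.
rewrite <- Rpow_mult_distr in HG.
apply R4_eq; field; now split.
Qed.

(** At [v = 0] the vanishing of the components [f' p] and [f' q] gives [f' = 0]
    because [p] and [q] have no common zero, and then [E <> 0] excludes [g' = 0]. *)
Lemma rotational_minimal (kappa alpha beta : R) (J : R -> Prop) (p q f g : R -> R) :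
  kappa ^ 2 = 1 -> hyperbolic_pair kappa beta p q ->
  timelike_meridian kappa alpha beta J f g ->
  is_minimal J (rotational alpha p q f g) <->
  (forall u, J u -> meridian_defect kappa alpha beta f g u = 0).
Proof.
intros Hk H Htl.
assert (HE : forall u, J u -> meridian_E kappa f g u <> 0).
{ intros u Ju E; destruct (Htl u Ju) as [E1 _]; rewrite E in E1; lra. }
assert (HG : forall u, J u -> meridian_G kappa alpha beta f g u <> 0).
{ intros u Ju E; destruct (Htl u Ju) as [_ E1]; rewrite E in E1; lra. }
split; intros Hm u.
- intros Ju; specialize (Hm u 0 Ju); specialize (HE u Ju); specialize (HG u Ju).
  rewrite (rotational_mean_curvature kappa alpha beta) in Hm by trivial.
  destruct (H 0) as [_ [_ Hpq]].
  set (c := - meridian_defect _ _ _ _ _ _ / _) in Hm.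
  assert (Hc : c = 0).
  { assert (H0 : 0 <= 0 < 2 * PI) by (pose proof PI_RGT_0; lra).
    specialize (Hm H0); rewrite Rmult_0_r, cos_0 in Hm.
    injection Hm as C1 _ C3 C4.
    apply NNPP; intros Hc.
    assert (Hp : Derive f u * p 0 = 0) by (apply Rmult_integral in C3 as [|]; easy).
    assert (Hq : Derive f u * q 0 = 0) by (apply Rmult_integral in C4 as [|]; easy).
    assert (Hg : kappa * Derive g u = 0)
      by (apply Rmult_integral in C1 as [|]; [easy|lra]).
    assert (Hk0 : kappa <> 0) by (intros K; rewrite K in Hk; lra).
    assert (f1 : Derive f u = 0).
    { apply Rmult_eq_reg_r with kappa; trivial; rewrite <- Hpq.
      transitivity (Derive f u * q 0 * q 0 - Derive f u * p 0 * p 0); [ring|].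
      rewrite Hp, Hq; ring. }
    apply HE; unfold meridian_E; rewrite f1.
    transitivity (- Derive g u * (kappa * Derive g u)); [ring|rewrite Hg; ring]. }
  unfold c in Hc.
  set (E := meridian_E kappa f g u) in *.
  set (G := meridian_G kappa alpha beta f g u) in *.
  assert (HEG : 2 * E ^ 2 * G <> 0).
  { repeat apply Rmult_integral_contrapositive_currified; try lra; trivial. }
  unfold Rdiv in Hc; apply Rmult_integral in Hc as [Hc|Hc]; [lra|].
  now apply Rinv_neq_0_compat in HEG.
- intros v Ju Hv; rewrite (rotational_mean_curvature kappa alpha beta) by auto.
  rewrite (Hm u Ju); unfold Rdiv; rewrite Ropp_0, !Rmult_0_l; reflexivity.
Qed.

(** Where [f = f' = 0], the normal plane is spanned by the first two coordinate
    directions and [z_uv], [z_vv] are tangent, so all three determinants vanish. *)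
Lemma rotational_no_inflection (kappa alpha beta : R) (J : R -> Prop) (p q f g : R -> R) :
  hyperbolic_pair kappa beta p q ->
  free_of_inflection_points J (rotational alpha p q f g) ->
  forall u, J u -> ~ (f u = 0 /\ Derive f u = 0).
Proof.
intros H Hinf u Ju [f0 f1].
apply (Hinf u 0 Ju); [pose proof PI_RGT_0; lra|].
exists (1, 0, 0, 0), (0, 1, 0, 0).
unfold orthonormal_normal_frame, Defs.Delta, z_uu, z_uv.
rewrite (rotational_z_vv kappa alpha beta p q f g u 0 H).
rewrite !rotational_d_u, !(rotational_d_v kappa alpha beta p q _ _ H).
unfold rotational; simpl mdot; rewrite f0, f1.
repeat split; ring.
Qed.

(** * The formulas for the meridian *)

(** The interval [J'] and the change of parameter [h] are eliminated here: comparing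
    the last varying coordinates of the two curves gives [h = g] on [J], and
    [J'] is the image of [J]. *)
Definition profile_arc (kappa alpha beta : R) (J : R -> Prop) (f g : R -> R) : Prop :=
  exists A C eps, (eps = 1 \/ eps = -1) /\ 0 <= A /\
    forall u, J u ->
      0 <= kappa * A + beta ^ 2 * g u ^ 2 /\
      beta * g u + sqrt (kappa * A + beta ^ 2 * g u ^ 2) <> 0 /\
      f u = profile kappa alpha beta A C eps (g u).

Lemma minimal_iff_profile_arc (kappa alpha beta : R) (J : R -> Prop) (p q f g : R -> R) :
  kappa ^ 2 = 1 -> hyperbolic_pair kappa beta p q -> 0 < alpha -> 0 < beta ->
  is_interval J -> smooth_on J f -> smooth_on J g ->
  timelike_meridian kappa alpha beta J f g ->
  free_of_inflection_points J (rotational alpha p q f g) ->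
  (forall u, J u -> Derive g u <> 0) ->
  is_minimal J (rotational alpha p q f g) <-> profile_arc kappa alpha beta J f g.
Proof.
intros Hk H Ha Hb HJ Hf Hg Htl Hinf Hg1.
rewrite (rotational_minimal kappa alpha beta) by trivial.
split.
- intros Heq.
  destruct (minimal_meridian_profile kappa alpha beta J f g) as [A [C [HA HC]]]; trivial.
  + now apply (rotational_no_inflection kappa alpha beta J p q f g).
  + exists A, C, 1; repeat split; [now left|lra|apply Rlt_le| |]; now apply HC.
- intros [A [C [eps [He [HA HC]]]]].
  apply (profile_meridian_defect kappa alpha beta A C eps); trivial.
  destruct He as [-> | ->]; ring.
Qed.

Lemma meridian1_determined_iff (alpha beta : R) (J : R -> Prop) (f g : R -> R) :
  is_interval J -> smooth_on J g -> (forall u, J u -> Derive g u <> 0) ->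
  meridian1_determined alpha beta J f g <-> profile_arc 1 alpha beta J f g.
Proof.
intros HJ Hg Hg1.
assert (E : forall A t, 1 * A + beta ^ 2 * t ^ 2 = A + beta ^ 2 * t ^ 2)
  by (intros; ring).
split.
- intros [A [C [eps [J' [He [Hd [h [_ [_ [HJ' Hx]]]]]]]]]].
  assert (P : forall u, J u -> profile1_defined beta A (g u) /\
                               f u = profile1 alpha beta A C eps (g u)).
  { intros u Ju; specialize (Hx u Ju); injection Hx as Ef Eg.
    rewrite Eg; split; trivial; apply Hd, HJ'; now exists u. }
  exists A, C, eps; split; [trivial|split].
  + destruct (proj2 HJ) as [a [_ [Ja _]]]; now apply (P a Ja).
  + intros u Ju; destruct (P u Ju) as [[_ [P1 P2]] P3]; unfold profile.
    rewrite !E; now repeat split.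
- intros [A [C [eps [He [HA HC]]]]].
  exists A, C, eps, (fun t => exists u, J u /\ g u = t); split; [trivial|split].
  + intros t [u [Ju <-]]; destruct (HC u Ju) as [P1 [P2 _]].
    unfold profile1_defined, log_arg1; rewrite E in P1, P2; now repeat split.
  + exists g; repeat split; trivial.
    intros u Ju; destruct (HC u Ju) as [_ [_ P3]]; unfold profile in P3.
    unfold meridian1, profile1, log_arg1; rewrite <- E; now rewrite P3 at 1.
Qed.

Lemma meridian2_determined_iff (alpha beta : R) (J : R -> Prop) (f g : R -> R) :
  is_interval J -> smooth_on J g -> (forall u, J u -> Derive g u <> 0) ->
  meridian2_determined alpha beta J f g <-> profile_arc (-1) alpha beta J f g.
Proof.
intros HJ Hg Hg1.
assert (E : forall A t, -1 * A + beta ^ 2 * t ^ 2 = beta ^ 2 * t ^ 2 - A)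
  by (intros; ring).
split.
- intros [A [C [eps [J' [He [Hd [h [_ [_ [HJ' Hx]]]]]]]]]].
  assert (P : forall u, J u -> profile2_defined beta A (g u) /\
                               f u = profile2 alpha beta A C eps (g u)).
  { intros u Ju; specialize (Hx u Ju); injection Hx as Ef Eg.
    rewrite Eg; split; trivial; apply Hd, HJ'; now exists u. }
  exists A, C, eps; split; [trivial|split].
  + destruct (proj2 HJ) as [a [_ [Ja _]]]; now apply (P a Ja).
  + intros u Ju; destruct (P u Ju) as [[_ [P1 P2]] P3]; unfold profile.
    rewrite !E; now repeat split.
- intros [A [C [eps [He [HA HC]]]]].
  exists A, C, eps, (fun t => exists u, J u /\ g u = t); split; [trivial|split].
  + intros t [u [Ju <-]]; destruct (HC u Ju) as [P1 [P2 _]].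
    unfold profile2_defined, log_arg2; rewrite E in P1, P2; now repeat split.
  + exists g; repeat split; trivial.
    intros u Ju; destruct (HC u Ju) as [_ [_ P3]]; unfold profile in P3.
    unfold meridian2, profile2, log_arg2; rewrite <- E; now rewrite P3 at 1.
Qed.

Lemma sinh_cosh_pair (beta : R) :
  hyperbolic_pair 1 beta (fun v => sinh (beta * v)) (fun v => cosh (beta * v)).
Proof.
intros v; unfold sinh, cosh; split; [|split].
- auto_derive; [trivial|field].
- auto_derive; [trivial|field].
- transitivity (exp (beta * v) * exp (- (beta * v))); [field|].
  rewrite <- exp_plus, Rplus_opp_r; apply exp_0.
Qed.

Lemma cosh_sinh_pair (beta : R) :
  hyperbolic_pair (-1) beta (fun v => cosh (beta * v)) (fun v => sinh (beta * v)).
Proof.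
intros v; destruct (sinh_cosh_pair beta v) as [H1 [H2 H3]]; split; [|split]; trivial; lra.
Qed.

Theorem theorem6p1
    (alpha beta : R) (Halpha : 0 < alpha) (Hbeta : 0 < beta)
    (J : R -> Prop) (HJ : is_interval J)
    (f g : R -> R) (Hf : smooth_on J f) (Hg : smooth_on J g) :
  (timelike_first_type alpha beta J f g ->
   free_of_inflection_points J (M1 alpha beta f g) ->
   (is_minimal J (M1 alpha beta f g) <-> meridian1_determined alpha beta J f g))
  /\
  (timelike_second_type alpha beta J f g ->
   free_of_inflection_points J (M2 alpha beta f g) ->
   ((forall u, J u -> Derive g u <> 0) ->
    (is_minimal J (M2 alpha beta f g) <-> meridian2_determined alpha beta J f g))
   /\
   (is_minimal J (M2 alpha beta f g) <->
    meridian2_determined_on_arcs alpha beta J f g)).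
Proof.
split.
- intros Htl Hinf.
  assert (Hg1 : forall u, J u -> Derive g u <> 0).
  { intros u Ju E; destruct (Htl u Ju) as [H _]; rewrite E in H.
    pose proof (pow2_ge_0 (Derive f u)); lra. }
  rewrite meridian1_determined_iff by trivial.
  apply minimal_iff_profile_arc; trivial; [ring|apply sinh_cosh_pair|].
  intros u Ju; destruct (Htl u Ju) as [HE HG]; unfold meridian_E, meridian_G; lra.
- intros Htl Hinf.
  assert (Htl' : timelike_meridian (-1) alpha beta J f g).
  { intros u Ju; destruct (Htl u Ju) as [HG HE]; unfold meridian_E, meridian_G; lra. }
  assert (Harc : forall I : R -> Prop, is_interval I -> (forall u, I u -> J u) ->
     (forall u, I u -> Derive g u <> 0) ->
     is_minimal I (M2 alpha beta f g) <-> meridian2_determined alpha beta I f g).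
  { intros I HI HIJ Hg1.
    pose proof (smooth_on_restrict I J f HIJ Hf) as HfI.
    pose proof (smooth_on_restrict I J g HIJ Hg) as HgI.
    rewrite meridian2_determined_iff by trivial.
    apply minimal_iff_profile_arc; trivial; [ring|apply cosh_sinh_pair| |].
    - intros u Iu; apply Htl'; auto.
    - intros u v Iu; apply Hinf; auto. }
  split; [intros Hg1; now apply Harc|].
  change (M2 alpha beta f g) with
    (rotational alpha (fun v => cosh (beta * v)) (fun v => sinh (beta * v)) f g) in *.
  assert (Hmin := fun I => rotational_minimal (-1) alpha beta I _ _ f g
                             ltac:(ring) (cosh_sinh_pair beta)).
  split.
  + intros Hm; split.
    * intros u d Ju Hd.
      apply (Derive_neq_0_dense (-1) alpha beta J f g); trivial; [|now apply Hmin].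
      intros x Jx g0; destruct (Htl x Jx) as [HG _]; rewrite g0 in HG.
      pose proof (pow2_ge_0 (alpha * f x)); rewrite Rpow_mult_distr in H; lra.
    * intros I HI HIJ Hg1; apply Harc; trivial.
      intros u v Iu; apply Hm; auto.
  + intros [Hdense Hdet]; apply Hmin; trivial.
    intros u Ju; apply eq_0_of_zeros_near; [now apply continuous_meridian_defect with J|].
    intros d Hd; destruct (Hdense u d Ju Hd) as [x [Jx [Hx g1]]].
    exists x; split; [trivial|].
    destruct (continuous_neq_0_near (Derive g) x) as [d' [Hd' Hn]]; trivial.
    { apply (ex_derive_continuous (Derive g)); eexists.
      now apply (smooth_on_derive J); [apply smooth_on_Derive|]. }
    pose (I := fun t => J t /\ Rabs (t - x) < d').
    assert (HI : is_interval I) by now apply is_interval_restrict.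
    assert (HIJ : forall t, I t -> J t) by now intros t [Jt _].
    assert (HI1 : forall t, I t -> Derive g t <> 0)
      by (intros t [_ Ht]; now apply Hn).
    apply (proj1 (Hmin I (fun t It => Htl' t (HIJ t It)))).
    * apply Harc; trivial; now apply Hdet.
    * split; [trivial|rewrite Rminus_diag, Rabs_R0; trivial].
Qed.
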